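(* Let $G_5 = (C_5, \mathrm{Unif}(\{1,\dots,5\}))$ be the pentagon (cycle graph on 5 vertices) with uniform distribution on its vertices. For every perfect probabilistic graph $G$, $$\overline{H}(G \wedge G_5) = \overline{H}(G) + \overline{H}(G_5) = H_\kappa(G) + \tfrac{1}{2}\log 5.$$
   Context: A probabilistic graph is a tuple $G=(\mathcal{V},\mathcal{E},P_V)$ where $(\mathcal{V},\mathcal{E})$ is a finite simple undirected graph and $P_V$ is a probability distribution on $\mathcal{V}$. It is called perfect if the graph $(\mathcal{V},\mathcal{E})$ is perfect, i.e. for every $\mathcal{S}\subset\mathcal{V}$ the induced subgraph on $\mathcal{S}$ has chromatic number equal to its clique number. AND product: $G_1\wedge G_2$ has vertex set $\mathcal{V}_1\times\mathcal{V}_2$, distribution $P_{V_1}P_{V_2}$ (product distribution), and two distinct vertices $(v_1,v_2),(v_1',v_2')$ are adjacent iff ($v_1=v_1'$ or $v_1v_1'\in\mathcal{E}_1$) and ($v_2=v_2'$ or $v_2v_2'\in\mathcal{E}_2$). $G^{\wedge n}$ is the $n$-fold AND product $G\wedge\dots\wedge G$. A coloring of $G$ is a map $c$ on $\mathcal{V}$ such that adjacent vertices receive different values. The chromatic entropy is $H_\chi(G)=\inf\{H(c(V)) : c \text{ a coloring of } G\}$, where $V\sim P_V$ and $H$ is Shannon entropy; all logarithms are in base 2. The complementary graph entropy is $\overline{H}(G)=\lim_{n\to\infty}\frac1n H_\chi(G^{\wedge n})$ (the limit exists). Körner graph entropy: let $\Gamma(G)$ be the collection of independent sets of vertices of $G$.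 Then $H_\kappa(G)=\min I(W;V)$, where $V\sim P_V$, $I$ is mutual information, and the minimum is over all conditional distributions $P_{W|V}$ of a random variable $W$ with values in $\Gamma(G)$ such that $V\in W$ with probability one. *)

(* Defs.v *)
From mathcomp Require Import all_boot all_order all_algebra.
From mathcomp Require Import all_classical all_reals all_analysis.
Set Implicit Arguments.
Unset Strict Implicit.
Unset Printing Implicit Defensive.
Import Order.TTheory GRing.Theory Num.Theory.
Import numFieldNormedType.Exports.
Local Open Scope ring_scope.

(** * Finite simple graphs *)

Record sgraph := SGraph {
  vertex :> finType;
  adj : rel vertex;
  adj_sym : symmetric adj;
  adj_irr : irreflexive adj }.

Definition coloring (G : sgraph) (C : eqType) (c : G -> C) : bool :=
  [forall x, forall y, adj x y ==> (c x != c y)].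

Definition clique (G : sgraph) (S : {set G}) : bool :=
  [forall x in S, forall y in S, (x != y) ==> adj x y].

Definition independent (G : sgraph) (S : {set G}) : bool :=
  [forall x in S, forall y in S, ~~ adj x y].

Definition colorable (G : sgraph) (k : nat) : bool :=
  [exists c : {ffun G -> 'I_k}, coloring c].

Lemma colorable_exists (G : sgraph) : exists k, colorable G k.
Proof.
exists #|G|; apply/existsP; exists [ffun x => enum_rank x].
apply/forallP => x; apply/forallP => y; apply/implyP => xy; rewrite !ffunE.
by apply: contraTneq xy => /enum_rank_inj ->; rewrite adj_irr.
Qed.

Definition chromatic_number (G : sgraph) : nat := ex_minn (colorable_exists G).

Definition clique_number (G : sgraph) : nat :=
  \max_(S : {set G} | clique S) #|S|.

Section Induced.
Variables (G : sgraph) (S : {set G}).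
Let induced_adj : rel {x : G | x \in S} := fun x y => adj (val x) (val y).
Let induced_sym : symmetric induced_adj.
Proof. by move=> x y; apply: adj_sym. Qed.
Let induced_irr : irreflexive induced_adj.
Proof. by move=> x; apply: adj_irr. Qed.
Definition induced_subgraph : sgraph := SGraph induced_sym induced_irr.
End Induced.

Definition perfect (G : sgraph) : Prop :=
  forall S : {set G},
    chromatic_number (induced_subgraph S) = clique_number (induced_subgraph S).

(** * Finite probability distributions and Shannon information *)

Record dist (R : realType) (T : finType) := Dist {
  dist_fun :> T -> R;
  dist_ge0 : forall x, 0 <= dist_fun x;
  dist_sum1 : \sum_x dist_fun x = 1 }.

Definition log2 (R : realType) (x : R) : R := ln x / ln 2.

Definition entropy (R : realType) (T : finType) (p : T -> R) : R :=
  - \sum_x p x * log2 (p x).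

(** Law of [f X] when [X] has law [p]. *)
Definition image_law (R : realType) (T C : finType) (f : T -> C) (p : T -> R)
  : C -> R := fun c => \sum_(x | f x == c) p x.

(** Mutual information of [X] and [Y] with joint law [p]. *)
Definition mutual_info (R : realType) (A B : finType) (p : A -> B -> R) : R :=
  \sum_a \sum_b
    p a b * log2 (p a b / ((\sum_b' p a b') * (\sum_a' p a' b))).

(** * Probabilistic graphs *)

Record pgraph (R : realType) := PGraph {
  pgraph_graph :> sgraph;
  pgraph_dist : dist R pgraph_graph }.

Section AndProduct.
Variables (R : realType) (G1 G2 : pgraph R).

Let and_adj : rel (G1 * G2)%type := fun u v =>
  [&& u != v, (u.1 == v.1) || adj u.1 v.1 & (u.2 == v.2) || adj u.2 v.2].
Let and_sym : symmetric and_adj.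
Proof.
move=> u v; rewrite /and_adj [v == u]eq_sym [v.1 == _]eq_sym [v.2 == _]eq_sym.
by rewrite [adj v.1 _]adj_sym [adj v.2 _]adj_sym.
Qed.
Let and_irr : irreflexive and_adj.
Proof. by move=> u; rewrite /and_adj eqxx. Qed.

Let and_pmf (u : G1 * G2) : R := pgraph_dist G1 u.1 * pgraph_dist G2 u.2.
Let and_pmf_ge0 u : 0 <= and_pmf u.
Proof. by apply: mulr_ge0; apply: dist_ge0. Qed.
Let and_pmf_sum1 : \sum_u and_pmf u = 1.
Proof.
rewrite -(pair_bigA _ (fun x y => pgraph_dist G1 x * pgraph_dist G2 y)) /=.
under eq_bigr do rewrite -mulr_sumr dist_sum1 mulr1.
exact: dist_sum1.
Qed.

Definition and_prod : pgraph R :=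
  @PGraph R (SGraph and_sym and_irr) (Dist and_pmf_ge0 and_pmf_sum1).
End AndProduct.

Section OneVertex.
Variable R : realType.
Let one_adj : rel unit := fun _ _ => false.
Let one_sym : symmetric one_adj. Proof. by []. Qed.
Let one_irr : irreflexive one_adj. Proof. by []. Qed.
Let one_ge0 (x : unit) : 0 <= (fun=> 1 : R) x. Proof. exact: ler01. Qed.
Let one_sum1 : \sum_(x : unit) (fun=> 1 : R) x = 1.
Proof. by rewrite sumr_const card_unit. Qed.
Definition one_graph : pgraph R :=
  @PGraph R (SGraph one_sym one_irr) (Dist one_ge0 one_sum1).
End OneVertex.

(** [G /\ (G /\ ... /\ G)] with [n] factors; the value [one_graph] at [n = 0]
    plays no role in the limit below. *)
Definition and_pow (R : realType) (G : pgraph R) (n : nat) : pgraph R :=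
  iterop n (@and_prod R) G (one_graph R).

(** As [G] is finite, every coloring takes its values in a finite set. *)
Definition chromatic_entropy (R : realType) (G : pgraph R) : R :=
  inf [set h | exists (C : finType) (c : G -> C),
    coloring c /\ h = entropy (image_law c (pgraph_dist G))]%classic.

(** The limit exists because [n |-> chromatic_entropy (and_pow G n)] is
    subadditive on positive [n]. *)
Definition complementary_entropy (R : realType) (G : pgraph R) : R :=
  limn (fun n : nat => n%:R^-1 * chromatic_entropy (and_pow G n)).

Definition indep_set (G : sgraph) : finType := {S : {set G} | independent S}.

(** The infimum ranges over the conditional laws [Q = P_{W|V}] on independent sets
    with [P (V \in W) = 1]; it is attained, by compactness. *)
Definition korner_entropy (R : realType) (G : pgraph R) : R :=
  inf [set h | exists Q : G -> dist R (indep_set G),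
    let joint v w := pgraph_dist G v * Q v w in
    \sum_v \sum_(w : indep_set G | v \in val w) joint v w = 1 /\
    h = mutual_info joint]%classic.

(** * The pentagon with uniform distribution *)

Section Pentagon.
Variable R : realType.
Let c5_adj : rel 'I_5 := fun i j =>
  (i.+1 %% 5 == j)%N || (j.+1 %% 5 == i)%N.
Let c5_sym : symmetric c5_adj.
Proof. by move=> i j; rewrite /c5_adj orbC. Qed.
Let c5_irr : irreflexive c5_adj.
Proof. by case; do 5?case=> //. Qed.
Let c5_ge0 (i : 'I_5) : 0 <= (fun=> 5^-1 : R) i.
Proof. by rewrite invr_ge0 ler0n. Qed.
Let c5_sum1 : \sum_(i < 5) (fun=> 5^-1 : R) i = 1.
Proof.
by rewrite sumr_const card_ord -[_ *+ _]mulr_natr mulVf // pnatr_eq0.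
Qed.
Definition pentagon : pgraph R :=
  @PGraph R (SGraph c5_sym c5_irr) (Dist c5_ge0 c5_sum1).
End Pentagon.

(* Main.v *)
Require Import Defs.
From mathcomp Require Import all_boot all_order all_algebra.
From mathcomp Require Import all_classical all_reals all_analysis.
From mathcomp Require Import ring lra.
Set Implicit Arguments.
Unset Strict Implicit.
Unset Printing Implicit Defensive.
Import Order.TTheory GRing.Theory Num.Theory.
Import numFieldNormedType.Exports.
Local Open Scope ring_scope.

(** In natural logarithms, call [theta_weight] a weight [t] coming from an
    orthonormal representation of [G] and [cover_weight] a point [a] of the stable
    set polytope. Both notions are multiplicative for the AND product. By Gibbs'
    inequality, [t] gives the lower bound [H(V) + sum P ln t] on the chromatic
    entropy (and on [I(W; V)]); greedy colouring turns [a] into the upper bound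
    [- sum P ln a], up to an error logarithmic in [ln (1 / min (P a))], hence
    sublinear on powers. For perfect [G], let [b] nearly maximize [sum P ln b] over
    convex combinations of cliques: [b] is a [theta_weight], the Kuhn-Tucker
    conditions put [a = P / b] (nearly) in the clique-constrained polytope, which
    is the stable set polytope by perfection, and the two bounds meet at
    [korner_entropy G]. For the pentagon they meet thanks to Lovasz's umbrella and
    Shannon's five-colouring of the square, and for [G /\ C_5] the products of the
    two certificates match. *)

(** * Lower bounds from orthonormal representations *)

Section Logarithm.
Variable R : realType.
Implicit Types x y p : R.

Lemma ln_le_sub1 x : 0 < x -> ln x <= x - 1.
Proof.
move=> x0; rewrite -{1}[x](subrK 1) addrC; apply: le_ln1Dx.
by rewrite ltrBrDr addNr.
Qed.

Lemma ln2_gt0 : 0 < ln (2 : R).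
Proof. by apply: ln_gt0; rewrite ltr1n. Qed.

Lemma mulr_gt0_factors x y : 0 <= x -> 0 <= y -> 0 < x * y -> 0 < x /\ 0 < y.
Proof.
rewrite !le_eqVlt => /predU1P[<-|->]; first by rewrite mul0r ltxx.
by move=> /predU1P[<-|->]; first by rewrite mulr0 ltxx.
Qed.

(** This is [ln x <= x - 1] at [x = r t / p], multiplied by [p]. Summed, it is Gibbs' inequality for
    the masses [p] against the masses [r t]. *)
Lemma gibbs_term p t r : 0 <= p -> 0 <= t -> 0 <= r ->
  (0 < p -> 0 < t) -> (0 < p -> 0 < r) ->
  p - r * t <= p * (ln p - ln t - ln r).
Proof.
rewrite le_eqVlt => /predU1P[<-|p0] t0 r0 tp rp.
  by rewrite mul0r sub0r oppr_le0 mulr_ge0.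
have {}t0 := tp p0; have {}r0 := rp p0.
have /ln_le_sub1 : 0 < r * t / p by rewrite divr_gt0 // mulr_gt0.
rewrite ln_div ?posrE ?mulr_gt0 // lnM ?posrE // -(ler_pM2l p0).
rewrite [p * (_ / p - 1)]mulrBr mulrCA mulfV ?gt_eqF // !mulr1 => h.
rewrite -[p * (ln p - ln t - ln r)]opprK lerNr opprB -mulrN !opprD !opprK.
by rewrite [- ln p + _]addrC addrAC [ln t + _]addrC.
Qed.

End Logarithm.

(** * Finite distributions: images, products and mixtures *)

Section Distributions.
Variable R : realType.

Lemma image_law_ge0 (T C : finType) (f : T -> C) (p : dist R T) c :
  0 <= image_law f p c.
Proof. by apply: sumr_ge0 => x _; apply: dist_ge0. Qed.

Lemma image_law_ge (T C : finType) (f : T -> C) (p : dist R T) x :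
  p x <= image_law f p (f x).
Proof.
rewrite /image_law (bigD1 x) //= lerDl; apply: sumr_ge0 => y _.
exact: dist_ge0.
Qed.

Lemma image_law_sum1 (T C : finType) (f : T -> C) (p : dist R T) :
  \sum_c image_law f p c = 1.
Proof. by rewrite -(dist_sum1 p) [RHS](partition_big f xpredT). Qed.

Definition prod_dist (I J : finType) (p : dist R I) (q : dist R J) :
  dist R (I * J)%type.
Proof.
exists (fun u => p u.1 * q u.2).
  by move=> u; apply: mulr_ge0; apply: dist_ge0.
rewrite -(pair_bigA _ (fun x y => p x * q y)) /=.
by under eq_bigr do rewrite -mulr_sumr dist_sum1 mulr1; rewrite dist_sum1.
Defined.

Lemma prod_dist_mean (I J : finType) (p : dist R I) (q : dist R J)
    (f : I -> R) (g : J -> R) :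
  \sum_(u : I * J) prod_dist p q u * (f u.1 * g u.2) =
  (\sum_i p i * f i) * (\sum_j q j * g j).
Proof.
rewrite -(pair_bigA _ (fun i j => p i * q j * (f i * g j))) /= mulr_suml.
apply: eq_bigr => i _; rewrite mulr_sumr; apply: eq_bigr => j _.
by rewrite mulrACA.
Qed.

Definition unif_dist (T : finType) (x : T) : dist R T.
Proof.
exists (fun=> #|T|%:R^-1); first by move=> _; rewrite invr_ge0 ler0n.
rewrite sumr_const -[_ *+ _]mulr_natr mulVf // pnatr_eq0 -lt0n.
by apply/card_gt0P; exists x.
Defined.

Lemma dist_inhabited (T : finType) (p : dist R T) : exists x : T, true.
Proof.
case: (pickP (@predT T)) => [x _|T0]; first by exists x.
by have := dist_sum1 p; rewrite big_pred0 // => /esym/eqP; rewrite oner_eq0.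
Qed.

(** The weights are [1] and [e] before normalization, so that mixing adds [e * q] to [p] and costs
    only a factor [1 + e]. *)
Definition mix_dist (T : finType) (e : R) (e0 : 0 <= e) (p q : dist R T) :
  dist R T.
Proof.
exists (fun x => (p x + e * q x) / (1 + e)).
  by move=> x; rewrite divr_ge0 ?addr_ge0 ?mulr_ge0 ?dist_ge0.
rewrite -mulr_suml big_split /= -mulr_sumr !dist_sum1 mulr1 divff //.
by rewrite gt_eqF // ltr_wpDr.
Defined.

Definition point_dist (T : finType) (x : T) : dist R T.
Proof.
exists (fun y => (y == x)%:R); first by move=> y; rewrite ler0n.
by rewrite (bigD1 x) //= eqxx big1 ?addr0 // => y /negPf ->.
Defined.

(** Written as a mean over vertices, the entropy of the colours can be compared with vertex weights
    term by term. *)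
Lemma entropy_image_law (T C : finType) (f : T -> C) (p : dist R T) :
  entropy (image_law f p) = - (\sum_x p x * ln (image_law f p (f x))) / ln 2.
Proof.
rewrite /entropy /log2 mulNr; congr (- _).
under eq_bigr do rewrite mulrA; rewrite -mulr_suml; congr (_ / _).
rewrite [RHS](partition_big f xpredT) //=; apply: eq_bigr => c _.
by rewrite mulr_suml; apply: eq_bigr => x /eqP ->.
Qed.

Lemma entropy_image_law_ge0 (T C : finType) (f : T -> C) (p : dist R T) :
  0 <= entropy (image_law f p).
Proof.
rewrite entropy_image_law divr_ge0 ?(ltW (ln2_gt0 _)) // oppr_ge0.
apply: sumr_le0 => x _; rewrite mulr_ge0_le0 ?dist_ge0 ?ln_le0 //.
rewrite -(image_law_sum1 f p) (bigD1 (f x)) //= lerDl.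
by apply: sumr_ge0 => c _; apply: image_law_ge0.
Qed.

End Distributions.

Section ThetaBound.
Variable R : realType.
Implicit Types G H : pgraph R.

Lemma and_pmfE G H u : pgraph_dist (and_prod G H) u =
  pgraph_dist G u.1 * pgraph_dist H u.2.
Proof. by []. Qed.

Lemma and_adjE G H (u v : and_prod G H) : adj u v =
  [&& u != v, (u.1 == v.1) || adj u.1 v.1 & (u.2 == v.2) || adj u.2 v.2].
Proof. by []. Qed.

(** At [t = P] this is minus the entropy of the vertex, in nats. *)
Definition weighted_cost G (t : G -> R) : R :=
  \sum_v pgraph_dist G v * ln (t v).

Lemma weighted_cost_prod G H (t : G -> R) (s : H -> R) :
  (forall v, 0 < pgraph_dist G v -> 0 < t v) ->
  (forall v, 0 < pgraph_dist H v -> 0 < s v) ->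
  weighted_cost (fun u : and_prod G H => t u.1 * s u.2) =
  weighted_cost t + weighted_cost s.
Proof.
move=> t0 s0; rewrite /weighted_cost.
have -> : \sum_v pgraph_dist (and_prod G H) v * ln (t v.1 * s v.2) =
  \sum_v (prod_dist (pgraph_dist G) (pgraph_dist H) v * (ln (t v.1) * 1) +
          prod_dist (pgraph_dist G) (pgraph_dist H) v * (1 * ln (s v.2))).
  apply: eq_bigr => -[v w] _; rewrite and_pmfE /= mulr1 mul1r -mulrDr.
  have := dist_ge0 (pgraph_dist G) v; rewrite le_eqVlt => /predU1P[<-|v0].
    by rewrite !mul0r.
  have := dist_ge0 (pgraph_dist H) w; rewrite le_eqVlt => /predU1P[<-|w0].
    by rewrite !(mulr0, mul0r).
  by rewrite lnM // posrE ?t0 ?s0.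
rewrite big_split /= (prod_dist_mean _ _ (fun x => ln (t x)) (fun=> 1)).
rewrite (prod_dist_mean _ _ (fun=> 1) (fun x => ln (s x))).
under [X in _ * X + _]eq_bigr do rewrite mulr1.
under [X in _ + X * _]eq_bigr do rewrite mulr1.
by rewrite !dist_sum1 mulr1 mul1r.
Qed.

(* A probabilistic form of an orthonormal representation with handle: [t v] is
   the common value of the mean and of the mean square of the random variable
   [f v], and [f v], [f w] are orthogonal when [v <> w] are non-adjacent. *)
Definition theta_weight (G : sgraph) (t : G -> R) : Prop :=
  exists (I : finType) (d : dist R I) (f : G -> I -> R),
  [/\ forall v, \sum_i d i * f v i = t v,
      forall v, \sum_i d i * f v i ^+ 2 = t v &
      forall v w, v != w -> ~~ adj v w -> \sum_i d i * (f v i * f w i) = 0].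

(** As [ln 0 = 0] here, a vertex of positive mass with [t v = 0] would contribute [0] instead of
    minus infinity; the positivity clause excludes it. *)
Definition theta_bound G (L : R) : Prop :=
  exists t : G -> R,
  [/\ theta_weight t, forall v, 0 < pgraph_dist G v -> 0 < t v &
      L <= weighted_cost t - weighted_cost (pgraph_dist G)].

Lemma theta_weight_ge0 (G : sgraph) (t : G -> R) v : theta_weight t -> 0 <= t v.
Proof.
case=> I [d [f [_ <- _]]]; apply: sumr_ge0 => i _.
by rewrite mulr_ge0 ?dist_ge0 ?sqr_ge0.
Qed.

(* If [X] is the sum of the [f v] over [S], then [E X = E X^2 = t S], whence
   [(t S)^2 <= t S]. *)
Lemma theta_weight_independent (G : sgraph) (t : G -> R) (S : {set G}) :
  theta_weight t -> independent S -> \sum_(v in S) t v <= 1.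
Proof.
case=> I [d [f [f1 f2 f0]]] /forall_inP indS.
set T := \sum_(v in S) t v; pose X i := \sum_(v in S) f v i.
have EX : \sum_i d i * X i = T.
  rewrite /X; under eq_bigr do rewrite mulr_sumr.
  by rewrite exchange_big; apply: eq_bigr => v _; apply: f1.
have EX2 : \sum_i d i * X i ^+ 2 = T.
  under eq_bigr do rewrite expr2 mulr_suml mulr_sumr.
  rewrite exchange_big; apply: eq_bigr => v vS /=.
  under eq_bigr do rewrite mulr_sumr mulr_sumr.
  rewrite exchange_big (bigD1 v) //= [X in _ + X]big1 ?addr0 ?f2 //.
  by move=> w /andP[wS wv]; apply: f0; [rewrite eq_sym|move/forall_inP: (indS _ vS) => ->].
have : 0 <= \sum_i d i * (X i - T) ^+ 2.
  by apply: sumr_ge0 => i _; rewrite mulr_ge0 ?dist_ge0 ?sqr_ge0.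
have -> : \sum_i d i * (X i - T) ^+ 2 =
    \sum_i (d i * X i ^+ 2 - d i * X i * (T *+ 2) + d i * T ^+ 2).
  by apply: eq_bigr => i _; ring.
rewrite big_split sumrB /= -!mulr_suml EX EX2 dist_sum1 => h.
have T0 : 0 <= T.
  by rewrite -EX2; apply: sumr_ge0 => i _; rewrite mulr_ge0 ?dist_ge0 ?sqr_ge0.
nra.
Qed.

(** Tensor product of the representations: distinct non-adjacent vertices of the AND product are
    distinct and non-adjacent in some coordinate, and that factor vanishes. *)
Lemma theta_weight_prod G H (t : G -> R) (s : H -> R) :
  theta_weight t -> theta_weight s ->
  theta_weight (fun u : and_prod G H => t u.1 * s u.2).
Proof.
move=> [I [d [f [f1 f2 f0]]]] [J [e [g [g1 g2 g0]]]].
exists (I * J)%type, (prod_dist d e), (fun u k => f u.1 k.1 * g u.2 k.2); split.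
- by move=> [v w]; rewrite prod_dist_mean f1 g1.
- move=> [v w] /=; under eq_bigr do rewrite exprMn.
  by rewrite (prod_dist_mean _ _ (fun i => f v i ^+ 2) (fun i => g w i ^+ 2)) f2 g2.
move=> [v w] [v' w'] neq; rewrite and_adjE neq /= negb_and !negb_or => nadj.
under eq_bigr do rewrite [X in _ * X]mulrACA.
rewrite (prod_dist_mean _ _ (fun i => f v i * f v' i) (fun i => g w i * g w' i)).
by case/orP: nadj => /andP[? ?]; [rewrite f0 // mul0r|rewrite g0 // mulr0].
Qed.

Lemma theta_bound_prod G H L M : theta_bound G L -> theta_bound H M ->
  theta_bound (and_prod G H) (L + M).
Proof.
move=> [t [tt t0 tL]] [s [ss s0 sM]].
exists (fun u => t u.1 * s u.2); split; first exact: theta_weight_prod.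
- move=> [v w]; rewrite and_pmfE.
  move=> /(mulr_gt0_factors (dist_ge0 _ _) (dist_ge0 _ _))[v0 w0].
  by rewrite mulr_gt0 ?t0 ?s0.
have -> : weighted_cost (pgraph_dist (and_prod G H)) =
    weighted_cost (pgraph_dist G) + weighted_cost (pgraph_dist H).
  exact: weighted_cost_prod.
rewrite weighted_cost_prod //; lra.
Qed.

Lemma and_powSS G n : and_pow G n.+2 = and_prod G (and_pow G n.+1).
Proof. by []. Qed.

Lemma theta_bound_pow G L n :
  theta_bound G L -> theta_bound (and_pow G n.+1) (n.+1%:R * L).
Proof.
move=> GL; elim: n => [|n IHn]; first by rewrite mul1r.
rewrite and_powSS -[n.+2]add1n natrD mulrDl mul1r.
exact: theta_bound_prod.
Qed.

(** Colour classes are independent, so the masses [q (c v) * t v], with [q] the law of the colour,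
    have total at most [\sum_k q k = 1]; Gibbs' inequality compares them with [P]. *)
Lemma theta_bound_chromatic_entropy G L :
  theta_bound G L -> L <= chromatic_entropy G * ln 2.
Proof.
move=> [t [tt t0 tL]]; rewrite -ler_pdivrMr ?ln2_gt0 //.
apply: lb_le_inf.
  exists (entropy (image_law id (pgraph_dist G))), G, id; split=> //.
  apply/forallP => x; apply/forallP => y; apply/implyP.
  by apply: contraTneq => ->; rewrite adj_irr.
move=> _ [C [c [/forallP colc ->]]]; rewrite entropy_image_law.
rewrite ler_pM2r ?invr_gt0 ?ln2_gt0 //.
set q := image_law c _; apply: le_trans tL _; rewrite -subr_ge0.
have -> : - (\sum_x pgraph_dist G x * ln (q (c x))) -
    (weighted_cost t - weighted_cost (pgraph_dist G)) =
    \sum_v pgraph_dist G v * (ln (pgraph_dist G v) - ln (t v) - ln (q (c v))).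
  under [RHS]eq_bigr do rewrite !mulrBr.
  by rewrite !sumrB /weighted_cost; ring.
have : 0 <= \sum_v (pgraph_dist G v - q (c v) * t v).
  rewrite sumrB dist_sum1 subr_ge0 (partition_big c xpredT) //=.
  rewrite -(image_law_sum1 c (pgraph_dist G)); apply: ler_sum => k _.
  under eq_bigr => v /eqP -> do [].
  rewrite -mulr_sumr -[leRHS]mulr1 ler_wpM2l ?image_law_ge0 //.
  have : independent [set v | c v == k].
    apply/forall_inP => v; rewrite inE => /eqP vk.
    apply/forall_inP => w; rewrite inE => /eqP wk.
    by apply: contraT; rewrite negbK => /(implyP (forallP (colc v) w)); rewrite vk wk eqxx.
  by move/(theta_weight_independent tt); under eq_bigl do rewrite inE.
move/le_trans; apply; apply: ler_sum => v _; apply: gibbs_term.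
- exact: dist_ge0.
- exact: theta_weight_ge0.
- exact: image_law_ge0.
- exact: t0.
- by move=> v0; apply: lt_le_trans v0 (image_law_ge _ _ _).
Qed.

End ThetaBound.

(** * Upper bounds from fractional covers by independent sets *)

Lemma independent_set1 (G : sgraph) (v : G) : independent (G := G) [set v].
Proof.
apply/forall_inP => x /finset.set1P ->; apply/forall_inP => y /finset.set1P ->.
by rewrite adj_irr.
Qed.

Section CoverBound.
Variable R : realType.
Implicit Types G H : pgraph R.

(* [a] is a point of the stable set polytope: [a v] is the probability that a
   random independent set contains [v]. *)
Definition cover_weight (G : sgraph) (a : G -> R) : Prop :=
  exists (I : finType) (d : dist R I) (S : I -> {set G}),
    (forall i, independent (S i)) /\
    (forall v, \sum_i d i * (v \in S i)%:R = a v).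

(** [k] is the entropy bound proper; [m] only controls the error of greedy colouring. Both add up
    along products. *)
Definition cover_bound G (k m : R) : Prop :=
  exists a : G -> R,
  [/\ cover_weight a, forall v, 0 < a v, - weighted_cost a <= k &
      forall v, 0 < pgraph_dist G v -> expR (- m) <= pgraph_dist G v * a v].

Lemma cover_weight_le1 (G : sgraph) (a : G -> R) v : cover_weight a -> a v <= 1.
Proof.
case=> I [d [S [_ <-]]]; rewrite -[leRHS](dist_sum1 d); apply: ler_sum => i _.
by rewrite ler_piMr ?dist_ge0 ?lern1 ?leq_b1.
Qed.

(** Within a product of independent sets, adjacency would force both coordinates to agree, hence the
    vertices to coincide. *)
Lemma cover_weight_prod G H (a : G -> R) (b : H -> R) :
  cover_weight a -> cover_weight b ->
  cover_weight (fun u : and_prod G H => a u.1 * b u.2).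
Proof.
move=> [I [d [S [indS Sa]]]] [J [e [T [indT Tb]]]].
exists (I * J)%type, (prod_dist d e), (fun k => finset.setX (S k.1) (T k.2)); split.
  move=> [i j]; apply/forall_inP => -[v w] /finset.setXP[vS wT].
  apply/forall_inP => -[v' w'] /finset.setXP[v'S w'T]; rewrite and_adjE /=.
  have /negPf -> : ~~ adj v v' by move: (indS i) => /forall_inP/(_ v vS)/forall_inP; apply.
  have /negPf -> : ~~ adj w w' by move: (indT j) => /forall_inP/(_ w wT)/forall_inP; apply.
  by rewrite !orbF xpair_eqE andNb.
move=> [v w] /=; rewrite -Sa -Tb -prod_dist_mean.
by apply: eq_bigr => -[i j] _; rewrite finset.in_setX /= -natrM mulnb.
Qed.

Lemma cover_bound_prod G H k m l n : cover_bound G k m -> cover_bound H l n ->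
  cover_bound (and_prod G H) (k + l) (m + n).
Proof.
move=> [a [aa a0 ak am]] [b [bb b0 bl bn]].
exists (fun u => a u.1 * b u.2); split.
- exact: cover_weight_prod.
- by move=> [v w]; apply: mulr_gt0.
- by rewrite weighted_cost_prod // opprD lerD.
move=> [v w]; rewrite and_pmfE.
move=> /(mulr_gt0_factors (dist_ge0 _ _) (dist_ge0 _ _))[v0 w0].
by rewrite opprD expRD mulrACA ler_pM ?expR_ge0 ?am ?bn.
Qed.

(** Preimages of independent sets under a homomorphism are independent. This serves to regroup the
    factors of [and_prod], which can be done only up to isomorphism. *)
Lemma cover_bound_transport G H (phi : G -> H) k m : bijective phi ->
  (forall u v, adj u v -> adj (phi u) (phi v)) ->
  (forall v, pgraph_dist G v = pgraph_dist H (phi v)) ->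
  cover_bound H k m -> cover_bound G k m.
Proof.
move=> bij_phi homo_phi PE [a [[I [d [S [indS Sa]]]] a0 ak am]].
exists (a \o phi); split=> //=.
- exists I, d, (fun i => phi @^-1: S i); split.
    move=> i; apply/forall_inP => v; rewrite inE => vS.
    apply/forall_inP => w; rewrite inE => wS; apply: contraTN isT => /homo_phi.
    by move: (indS i) => /forall_inP/(_ _ vS)/forall_inP/(_ _ wS)/negPf ->.
  by move=> v; under eq_bigr do rewrite inE; rewrite Sa.
- apply: le_trans ak; rewrite lerN2 /weighted_cost (reindex phi) /=.
    by under [leRHS]eq_bigr do rewrite PE.
  exact: onW_bij.
by move=> v; rewrite PE; apply: am.
Qed.

Lemma cover_bound_le G k m l n : k <= l -> m <= n ->
  cover_bound G k m -> cover_bound G l n.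
Proof.
move=> kl mn [a [aa a0 ak am]]; exists a; split=> //; first exact: le_trans kl.
by move=> v v0; apply: le_trans (am v v0); rewrite ler_expR lerN2.
Qed.

Lemma cover_weight_bound G (a : G -> R) k : cover_weight a ->
  (forall v, 0 < a v) -> - weighted_cost a <= k -> exists m, cover_bound G k m.
Proof.
(* A crude [m]: the sum of all the absolute logarithms dominates each of them. *)
move=> aa a0 ak; exists (\sum_v `|ln (pgraph_dist G v * a v)|), a; split=> // v v0.
have Pa : 0 < pgraph_dist G v * a v by apply: mulr_gt0.
rewrite -[leRHS]lnK // ler_expR lerNl (bigD1 v) //= ler_wpDr //.
  exact: sumr_ge0.
by rewrite -normrN ler_norm.
Qed.

(** A uniform random singleton; this handles the leftover factor of an odd power. *)
Lemma cover_bound_trivial G : exists k m, cover_bound G k m.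
Proof.
have [x _] := dist_inhabited (pgraph_dist G).
have N0 : 0 < #|G|%:R :> R by rewrite ltr0n; apply/card_gt0P; exists x.
exists (- weighted_cost (fun _ : G => #|G|%:R^-1)).
apply: (@cover_weight_bound _ (fun=> #|G|%:R^-1)) => // [|_]; last by rewrite invr_gt0.
exists G, (unif_dist R x), (fun v => [set v]); split=> v; first exact: independent_set1.
rewrite (bigD1 v) //= finset.in_set1 eqxx mulr1 big1 ?addr0 // => w wv.
by rewrite finset.in_set1 eq_sym (negPf wv) mulr0.
Qed.

Lemma cover_bound_assoc G H X k m :
  cover_bound (and_prod (and_prod G H) X) k m ->
  cover_bound (and_prod G (and_prod H X)) k m.
Proof.
pose phi (u : and_prod G (and_prod H X)) : and_prod (and_prod G H) X :=
  (u.1, u.2.1, u.2.2).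
apply: (@cover_bound_transport _ _ phi).
- by exists (fun u => (u.1.1, (u.1.2, u.2))) => [[? []]|[[]]].
- move=> [u [v w]] [u' [v' w']]; rewrite !and_adjE /= !xpair_eqE.
  case: (u == u') (v == v') (w == w') => -[] [] //=;
  by case: (adj u u') (adj v v') (adj w w') => -[] [].
by move=> [u [v w]]; rewrite !and_pmfE mulrA.
Qed.

(** Lets covers of the squares of [G] and of [H] be multiplied into a cover of the square of
    [and_prod G H]. *)
Lemma cover_bound_swap G H k m :
  cover_bound (and_prod (and_prod G G) (and_prod H H)) k m ->
  cover_bound (and_prod (and_prod G H) (and_prod G H)) k m.
Proof.
pose phi (u : and_prod (and_prod G H) (and_prod G H)) :
  and_prod (and_prod G G) (and_prod H H) :=
  (u.1.1, u.2.1, (u.1.2, u.2.2)).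
apply: (@cover_bound_transport _ _ phi).
- by exists (fun u => (u.1.1, u.2.1, (u.1.2, u.2.2))) => [[[? ?] []]|[[? ?] []]].
- move=> [[u v] [w x]] [[u' v'] [w' x']]; rewrite !and_adjE /= !xpair_eqE.
  case: (u == u') (v == v') (w == w') (x == x') => -[] [] [] //=;
  by case: (adj u u') (adj v v') (adj w w') (adj x x') => -[] [] [].
by move=> [[u v] [w x]]; rewrite !and_pmfE mulrACA.
Qed.

(** The pentagon has a good cover on its square but not on one factor, hence the hypothesis on the
    square; [K] absorbs the single factor left in odd powers. *)
Lemma cover_bound_pow G k m : cover_bound (and_prod G G) (2 * k) (2 * m) ->
  exists K, forall n,
    cover_bound (and_pow G n.+1) (n.+1%:R * k + K) (n.+1%:R * m + K).
Proof.
move=> GG; have [l [p Glp]] := cover_bound_trivial G.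
pose K := `|l - k| + `|p - m|; exists K.
have K0 : 0 <= K by rewrite addr_ge0.
have base : cover_bound G (1 * k + K) (1 * m + K).
  apply: cover_bound_le Glp; rewrite mul1r -lerBlDl (le_trans (ler_norm _)) //.
    by rewrite lerDl.
  by rewrite lerDr.
(* Powers 1 and 2 are the base cases; power [n.+3] is the square times power [n.+1]. *)
elim/ltn_ind => -[_|[_|n IHn]] //.
  by apply: cover_bound_le GG; rewrite lerDl.
rewrite !and_powSS; apply: cover_bound_assoc.
apply: cover_bound_le (cover_bound_prod GG (IHn n (leqnSn _))).
  by rewrite addrA -mulrDl -natrD add2n.
by rewrite addrA -mulrDl -natrD add2n.
Qed.

End CoverBound.

(** * Greedy colouring from a fractional cover *)

Section Greedy.
Variable R : realType.
Variable G : pgraph R.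
Implicit Types U C : {set G}.
Local Notation P := (pgraph_dist G).

(** Averaging: the mass of [U :&: S i] has mean [\sum_(v in U) P v * a v], so some [i] reaches
    it. *)
Lemma cover_weight_heavy (a : G -> R) U : cover_weight a ->
  exists C, [/\ C \subset U, independent C &
    \sum_(v in U) P v * a v <= \sum_(v in C) P v].
Proof.
case=> I [d [S [indS Sa]]]; set A := \sum_(v in U) _.
pose x i := \sum_(v in U :&: S i) P v.
have Ax : \sum_i d i * x i = A.
  rewrite /A; under [RHS]eq_bigr do rewrite -Sa mulr_sumr.
  rewrite [RHS]exchange_big; apply: eq_bigr => i _ /=.
  have -> : x i = \sum_(v in U | v \in S i) P v by apply: eq_bigl => v; rewrite finset.in_setI.
  rewrite big_mkcondr mulr_sumr; apply: eq_bigr => v _.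
  by case: ifP => _; rewrite ?(mulr0, mulr1) // mulrC.
case: (pickP (fun i => A <= x i)) => [i Ai|noi].
  exists (U :&: S i); split=> //; first exact: finset.subsetIl.
  apply/forall_inP => v /finset.setIP[_ vS]; apply/forall_inP => w /finset.setIP[_ wS].
  by move: (indS i) => /forall_inP/(_ _ vS)/forall_inP; apply.
have ltA i : x i < A by rewrite ltNge noi.
have Ax0 i : 0 <= d i * (A - x i) by rewrite mulr_ge0 ?dist_ge0 // subr_ge0 ltW.
have : \sum_i d i * (A - x i) = 0.
  by under eq_bigr do rewrite mulrBr; rewrite sumrB -mulr_suml dist_sum1 mul1r Ax subrr.
move/psumr_eq0P => d0.
have := dist_sum1 d; rewrite big1 => [/esym/eqP|i _]; first by rewrite oner_eq0.
have /eqP := d0 (fun j _ => Ax0 j) i isT.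
by rewrite mulf_eq0 [A - _ == 0]gt_eqF ?orbF ?subr_gt0 // => /eqP.
Qed.

(* Repeatedly remove from [U] a heaviest independent class: each step costs
   [1 - A' / A <= ln (A / A')], where [A] and [A'] are the masses of [P a] on
   what remains before and after the step. *)
Lemma greedy_classes (a : G -> R) (m : R) U : cover_weight a -> 0 < m ->
  U != finset.set0 -> (forall v, v \in U -> m <= P v * a v) ->
  exists c : G -> {set G},
  [/\ forall v, v \in U -> [/\ v \in c v, c v \subset U & independent (c v)],
      forall u v, v \in U -> u \in c v -> c u = c v &
      \sum_(v in U) P v * a v / (\sum_(u in c v) P u) <=
        1 + ln (\sum_(v in U) P v * a v) - ln m].
Proof.
move=> aa m0; elim: {U}#|U| {-2}U (leqnn #|U|) => [|n IHn] U.
  by rewrite leqn0 cards_eq0 => /eqP ->; rewrite eqxx.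
move=> leUn U0 mPa; have [C [sCU indC AC]] := cover_weight_heavy U aa.
pose A (B : {set G}) := \sum_(v in B) P v * a v.
have leA B : B != finset.set0 -> B \subset U -> m <= A B.
  case/finset.set0Pn => v vB sBU; rewrite /A (bigD1 v) //= ler_wpDr ?mPa ?(fintype.subsetP sBU) //.
  apply: sumr_ge0 => w /andP[wB _]; apply: le_trans (ltW m0) (mPa w _).
  exact: (fintype.subsetP sBU).
have mA := leA U U0 (subxx _).
have A0 : 0 < A U by apply: lt_le_trans mA.
have PC0 : 0 < \sum_(v in C) P v by apply: lt_le_trans AC.
have AUC : A U = A C + A (U :\: C).
  by rewrite /A (finset.big_setID C) /= (finset.setIidPr sCU).
(* A class that exhausts [U] costs at most 1, which is the constant of the bound, and
   [ln m <= ln (A U)]. *)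
have [UC0|UC0] := eqVneq (U :\: C) finset.set0.
  have UC : U = C by apply/eqP; rewrite finset.eqEsubset sCU andbT -finset.setD_eq0 UC0.
  exists (fun=> C); split; [by move=> v; rewrite UC; split| by [] |].
  rewrite -mulr_suml -addrA ler_wpDr //; last by rewrite ler_pdivrMr // mul1r.
  by rewrite subr_ge0 ler_ln ?posrE.
have [|v|c [cU cc cA]] := IHn (U :\: C) _ UC0.
- rewrite -ltnS; apply: leq_trans leUn; apply: proper_card.
  rewrite finset.properEneq finset.subsetDl andbT; apply: contraTneq PC0 => UCU.
  suff -> : C = finset.set0 by rewrite finset.big_set0 ltxx.
  apply/finset.setP => v; rewrite finset.in_set0; apply/negP => vC.
  by have := fintype.subsetP sCU v vC; rewrite -UCU inE vC.
- by move=> /finset.setDP[vU _]; apply: mPa.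
exists (fun v => if v \in C then C else c v); split.
- move=> v vU; case: ifPn => vC //.
  have [|vcv scv ind] := cU v; first by rewrite inE vC.
  by split=> //; apply: fintype.subset_trans scv (finset.subsetDl _ _).
- move=> u v vU; case: (boolP (v \in C)) => [vC -> //|vC ucv].
  have vUC : v \in U :\: C by rewrite inE vC.
  have [_ /fintype.subsetP/(_ u ucv)] := cU v vUC.
  by rewrite inE => /andP[/negPf -> _] _; apply: cc.
rewrite (finset.big_setID C) /= (finset.setIidPr sCU).
have -> : \sum_(v in C) P v * a v / (\sum_(u in if v \in C then C else c v) P u) =
    A C / \sum_(u in C) P u.
  by rewrite /A mulr_suml; apply: eq_bigr => v ->.
have -> : \sum_(v in U :\: C) P v * a v / (\sum_(u in if v \in C then C else c v) P u) =
    \sum_(v in U :\: C) P v * a v / (\sum_(u in c v) P u).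
  by apply: eq_bigr => v /finset.setDP[_ /negPf ->].
have A'0 : 0 < A (U :\: C) by apply: lt_le_trans (leA _ UC0 (finset.subsetDl _ _)).
have : A C / (\sum_(u in C) P u) <= A C / A U.
  rewrite ler_wpM2l ?lef_pV2 ?posrE //.
  by apply: sumr_ge0 => v vC; apply: le_trans (ltW m0) (mPa v _); apply: (fintype.subsetP sCU).
have -> : A C / A U = 1 - A (U :\: C) / A U.
  by rewrite AUC; field; rewrite -AUC gt_eqF.
have : ln (A (U :\: C) / A U) <= A (U :\: C) / A U - 1.
  by apply: ln_le_sub1; rewrite divr_gt0.
rewrite ln_div ?posrE // -/(A _); move: cA; rewrite -/(A _); lra.
Qed.

(** With [s] the mass of the greedy class of [v], [ln x <= x - 1] at [x = e * a v / s] bounds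
    [- ln s] by [- ln (a v) + e * a v / s - ln e], and [a v / s] has mean at most [1 + m]. Taking
    [e = 1 / (1 + m)] would give the logarithmic error; a fixed small [e] is enough for the
    limit. *)
Lemma cover_bound_chromatic_entropy k m e : 0 < e -> cover_bound G k m ->
  chromatic_entropy G * ln 2 <= k + e * (1 + m) - ln e.
Proof.
move=> e0 [a [aa a0 ak am]]; pose U := [set v | 0 < P v].
have U0 : U != finset.set0.
  apply: contraTneq (oner_neq0 R) => U0; rewrite -(dist_sum1 P) big1 ?eqxx // => v _.
  apply/eqP; rewrite eq_le dist_ge0 andbT leNgt.
  by have := finset.in_set0 v; rewrite -U0 inE => ->.
have [|c [cU cc cA]] := greedy_classes aa (expR_gt0 (- m)) U0.
  by move=> v; rewrite inE; apply: am.
(* The greedy classes stay inside the support; each vertex of mass zero gets a colour of its own. *)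
pose c' v := if v \in U then c v else [set v].
have col : coloring c'.
  apply/forallP => x; apply/forallP => y; apply/implyP; apply: contraTneq.
  rewrite /c'; case: ifPn => xU; case: ifPn => yU.
  - move=> cxy; have [xx _ /forall_inP/(_ x xx)/forall_inP ind] := cU x xU.
    by apply: ind; rewrite cxy; have [] := cU y yU.
  - move=> cxy; have [_ /fintype.subsetP/(_ y)] := cU x xU.
    by rewrite cxy finset.set11 (negPf yU) => /(_ isT).
  - move=> cxy; have [_ /fintype.subsetP/(_ x)] := cU y yU.
    by rewrite -cxy finset.set11 (negPf xU) => /(_ isT).
  - by move=> /finset.set1_inj ->; rewrite adj_irr.
rewrite -ler_pdivlMr ?ln2_gt0 //.
apply: (@le_trans _ _ (entropy (image_law c' P))).
  apply: ge_inf; last by exists {set G}, c'.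
  by exists 0 => _ [C [f [_ ->]]]; apply: entropy_image_law_ge0.
rewrite entropy_image_law ler_pM2r ?invr_gt0 ?ln2_gt0 //.
set q := image_law c' P.
have Pq v : v \in U -> \sum_(u in c v) P u <= q (c' v).
  move=> vU; rewrite /q /image_law [leRHS](bigID (mem (c v))) /=.
  rewrite (eq_bigl (fun u => (c' u == c' v) && (u \in c v))) ?lerDl.
    by apply: sumr_ge0 => u _; apply: dist_ge0.
  move=> u; case: (boolP (u \in c v)) => [ucv|]; rewrite ?andbF // andbT.
  have uU : u \in U by have [_ /fintype.subsetP s _] := cU v vU; apply: s.
  by rewrite /c' uU vU (cc _ v) ?eqxx.
have sumU (F : G -> R) : \sum_v P v * F v = \sum_(v in U) P v * F v.
  rewrite [RHS]big_mkcond; apply: eq_bigr => v _; rewrite inE; case: ltgtP => //.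
    by rewrite ltNge dist_ge0.
  by move=> <-; rewrite mul0r.
have AU1 : \sum_(v in U) P v * a v <= 1.
  rewrite -sumU -(dist_sum1 P); apply: ler_sum => v _.
  by rewrite ler_piMr ?dist_ge0 // cover_weight_le1.
have step v : v \in U -> P v * - ln (q (c' v)) <=
    P v * (- ln (a v)) + e * (P v * a v / (\sum_(u in c v) P u)) + P v * (- ln e).
  move=> vU; have Pv : 0 < P v by move: vU; rewrite inE.
  set s := \sum_(u in c v) P u; have s0 : 0 < s.
    have [vcv _ _] := cU v vU; rewrite /s (bigD1 v) //= ltr_wpDr //.
    by apply: sumr_ge0 => *; apply: dist_ge0.
  have sq : ln s <= ln (q (c' v)).
    by rewrite ler_ln ?posrE ?Pq // (lt_le_trans s0 (Pq _ vU)).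
  have := ln_le_sub1 (mulr_gt0 e0 (divr_gt0 (a0 v) s0)).
  rewrite lnM ?posrE ?divr_gt0 // ln_div ?posrE // => h.
  rewrite -mulrA mulrCA -!mulrDr ler_pM2l //; lra.
apply: (@le_trans _ _ (\sum_(v in U) (P v * (- ln (a v)) +
    e * (P v * a v / (\sum_(u in c v) P u)) + P v * (- ln e)))).
  rewrite -sumrN; under eq_bigr do rewrite -mulrN.
  by rewrite sumU; apply: ler_sum => v; apply: step.
rewrite !big_split /= -!sumU -mulr_sumr -mulr_suml dist_sum1 mul1r lerD2r lerD //.
  by apply: le_trans ak; rewrite /weighted_cost -sumrN; under eq_bigr do rewrite mulrN.
rewrite ler_pM2l //; apply: le_trans cA _; rewrite expRK opprK lerD2r -[leRHS]addr0 lerD2l.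
exact: ln_le0.
Qed.

End Greedy.

(** * The limit, and the pentagon *)

Section Limit.
Variable R : realType.

(** Both certificates may have slack [e], since those of perfect graphs are only approximate. *)
Lemma complementary_entropy_eq (G : pgraph R) (L : R) :
  (forall e, 0 < e -> theta_bound G (L - e)) ->
  (forall e, 0 < e -> exists m, cover_bound (and_prod G G) (2 * (L + e)) m) ->
  complementary_entropy G = L / ln 2.
Proof.
move=> lb ub; rewrite /complementary_entropy; apply/cvg_lim => //.
apply/cvgrPdist_le => e e0.
have l2 := ln2_gt0 R.
(* The upper bound spends [d] three times: on the slack of the cover, on [h * m2], and on the
   constant [K2], at most [n d] for large [n]. *)
pose d := e * ln 2 / 3; have d0 : 0 < d by rewrite divr_gt0 ?mulr_gt0.
have [m] := ub d d0; rewrite -[m](@mulfVK _ 2) ?pnatr_eq0 // [m / 2 * 2]mulrC.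
set m2 := m / 2 => /cover_bound_pow [K GK].
pose h := d / (`|m2| + 1).
have h0 : 0 < h by rewrite divr_gt0 // ltr_wpDl.
have hm : h * m2 <= d.
  rewrite /h mulrAC ler_pdivrMr ?ltr_wpDl // ler_pM2l //.
  by rewrite (le_trans (ler_norm _)) // lerDl.
pose K2 := `|K + h * (1 + K) - ln h|.
near=> n; have n0 : (0 < n)%N by near: n; exact: nbhs_infty_gt.
have nK : K2 / d <= n%:R by near: n; exact: nbhs_infty_ger.
rewrite ler_pdivrMr // in nK.
have nR0 : 0 < n%:R :> R by rewrite ltr0n.
have low : n%:R * (L - d) <= chromatic_entropy (and_pow G n) * ln 2.
  by rewrite -(prednK n0); apply/theta_bound_chromatic_entropy/theta_bound_pow/lb.
have up : chromatic_entropy (and_pow G n) * ln 2 <= n%:R * (L + d + d + d).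
  have /(cover_bound_chromatic_entropy h0) := GK n.-1; rewrite (prednK n0).
  move/le_trans; apply.
  have := ler_norm (K + h * (1 + K) - ln h); rewrite -/K2 => hK.
  have : n%:R * (h * m2) <= n%:R * d by rewrite ler_pM2l.
  lra.
set H := chromatic_entropy _ in low up *.
have -> : L / ln 2 - n%:R^-1 * H = (n%:R * L - H * ln 2) / (n%:R * ln 2).
  by field; rewrite !gt_eqF.
rewrite normrM normfV (gtr0_norm (mulr_gt0 nR0 l2)) ler_pdivrMr ?mulr_gt0 //.
have -> : e * (n%:R * ln 2) = n%:R * d + n%:R * d + n%:R * d.
  by rewrite /d; field.
by rewrite ler_norml; apply/andP; split; lra.
Unshelve. all: by end_near.
Qed.

End Limit.

Section Pentagon.
Variable R : realType.
Local Notation C5 := (pentagon R).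

Lemma weighted_cost_const (G : pgraph R) (x : R) :
  weighted_cost (fun _ : G => x) = ln x.
Proof. by rewrite /weighted_cost -mulr_suml dist_sum1 mul1r. Qed.

(* Lovasz's umbrella in circulant form: [f v i = g (i - v)] on the uniform space
   Z/5, where [g k = 1/sqrt 5 + b cos (2 pi k / 5)] has mean and mean square
   [1 / sqrt 5] and autocorrelation [0] at lag 2. *)
Lemma pentagon_theta_weight :
  theta_weight (G := C5) (fun=> Num.sqrt 5 / 5 : R).
Proof.
set s := Num.sqrt (5 : R); have s2 : s * s = 5 by rewrite -expr2 sqr_sqrtr.
have s1 : 1 <= s by rewrite -sqrtr1 ler_wsqrtr // ler1n.
(* Solves [1 / 5 + b ^+ 2 / 2 = 1 / sqrt 5], the mean square condition. *)
pose b : R := Num.sqrt (2 * (s - 1) / 5).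
have b2 : b * b = 2 * (s - 1) / 5.
  by rewrite -expr2 sqr_sqrtr // divr_ge0 // mulr_ge0 // subr_ge0.
(* Values of the circulant function at 0, 1 and 2: the cosines of [2 pi / 5] and [4 pi / 5] are
   [(s - 1) / 4] and [- (s + 1) / 4]. *)
pose x : R := s / 5 + b; pose y : R := s / 5 + b * (s - 1) / 4.
pose z : R := s / 5 - b * (s + 1) / 4.
have mean : 5^-1 * (x + 2 * y + 2 * z) = s / 5 by rewrite /x /y /z; field.
have sqr : 5^-1 * (x ^+ 2 + 2 * y ^+ 2 + 2 * z ^+ 2) = s / 5.
  rewrite /x /y /z.
  transitivity (s * s / 25 + 5^-1 * (b * b) * (1 + (s * s + 1) / 4)); first by field.
  by rewrite b2 s2; field.
have lag2 : 2 * x * z + 2 * y * z + y ^+ 2 = 0.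
  rewrite /x /y /z.
  transitivity (s * s / 5 - b * b * (s * s + 10 * s + 5) / 16); first by field.
  rewrite b2 s2; transitivity (1 - (s * s - 1) / 4); first by field.
  by rewrite s2; field.
pose g k : R := nth 0 [:: x; y; z; z; y] k.
exists 'I_5, (pgraph_dist C5), (fun v i : 'I_5 => g ((i + (5 - v)) %% 5)%N); split.
- by case=> [[|[|[|[|[|//]]]]] lt5]; rewrite -mean !big_ord_recr big_ord0 /= /g /=; ring.
- by case=> [[|[|[|[|[|//]]]]] lt5]; rewrite -sqr !big_ord_recr big_ord0 /= /g /=; ring.
(* Once equal and adjacent pairs are discharged, the lag is 2 or 3; both give the same
   autocorrelation, as [g] is even. *)
case=> [[|[|[|[|[|//]]]]] lt5]; case=> [[|[|[|[|[|//]]]]] lt5'] // _ _;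
  rewrite !big_ord_recr big_ord0 /= /g /=;
  by transitivity (5^-1 * (2 * x * z + 2 * y * z + y ^+ 2));
    [ring|rewrite lag2 mulr0].
Qed.

(** The vertex entropy is [ln 5], and the constant weight [1 / sqrt 5] takes half of it away. *)
Lemma pentagon_theta_bound : theta_bound C5 (ln 5 / 2).
Proof.
have s0 : 0 < Num.sqrt (5 : R) by rewrite sqrtr_gt0 ltr0n.
exists (fun=> Num.sqrt 5 / 5); split; first exact: pentagon_theta_weight.
  by move=> v _; rewrite divr_gt0.
have -> : weighted_cost (pgraph_dist C5) = ln 5^-1 by apply: (@weighted_cost_const C5).
rewrite weighted_cost_const ln_div ?posrE // lnV ?posrE //.
have <- : Num.sqrt 5 ^+ 2 = 5 :> R by rewrite sqr_sqrtr.
by rewrite sqrtr_sqr gtr0_norm // lnXn // -mulr_natr; lra.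
Qed.

(* Shannon's five-colouring of the square of the pentagon: the classes are the
   lines [j = 2 i + k] of Z/5 x Z/5. *)
Lemma pentagon_cover_bound : exists m, cover_bound (and_prod C5 C5) (ln 5) m.
Proof.
apply: (@cover_weight_bound _ _ (fun=> 5^-1)) => [|_|]; last first.
- by rewrite weighted_cost_const lnV ?posrE // opprK.
- by rewrite invr_gt0.
exists 'I_5, (pgraph_dist C5),
  (fun k => [set u : and_prod C5 C5 | val u.2 == (2 * val u.1 + val k) %% 5]%N).
split=> [k|[i j]].
  pose c5 i j := (i.+1 %% 5 == j)%N || (j.+1 %% 5 == i)%N.
  (* On a line, first coordinates at distance 1 give second coordinates at distance 2; checked
     exhaustively. *)
  have key : all (fun k => all (fun i => all (fun i' => (i != i') && c5 i i' ==>
      ~~ (((2 * i + k) %% 5 == (2 * i' + k) %% 5)%N ||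
          c5 ((2 * i + k) %% 5)%N ((2 * i' + k) %% 5)%N))
    (iota 0 5)) (iota 0 5)) (iota 0 5) by vm_compute.
  have in5 (i : 'I_5) : val i \in iota 0 5 by rewrite mem_iota /= ltn_ord.
  apply/forall_inP => -[i j]; rewrite inE => /eqP; rewrite [X in X = _]/= => ji.
  apply/forall_inP => -[i' j']; rewrite inE => /eqP; rewrite [X in X = _]/= => ji'.
  rewrite and_adjE xpair_eqE /=.
  move/allP/(_ _ (in5 k))/allP/(_ _ (in5 i))/allP/(_ _ (in5 i')): key.
  rewrite -ji -ji' /= -!(inj_eq val_inj) /=.
  rewrite -/(c5 i i') -/(c5 j j').
  have [ii'|_] := eqVneq (val i) (val i').
    have jj' : val j = val j' by rewrite [LHS]ji [RHS]ji' [val (i, j).1]ii'.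
    by have -> : (nat_of_ord j == nat_of_ord j') by apply/eqP.
  by case: (c5 _ _) (c5 _ _) (_ == _) => -[] [].
(* Each vertex of the square lies on exactly one of the five lines, hence the weight [1 / 5]. *)
by case: i j => [[|[|[|[|[|//]]]]] lt5] [[|[|[|[|[|//]]]]] lt5'];
  rewrite !big_ord_recr big_ord0 /= !inE /= ?(mulr0, mulr1, add0r, addr0).
Qed.

End Pentagon.

(** * Perfect graphs *)

Section PerfectCover.
Variable G : sgraph.
Implicit Types K S : {set G}.

Lemma clique_independent_le1 K S : clique K -> independent S ->
  (\sum_(v in K) (v \in S) <= 1)%N.
Proof.
move=> /forall_inP clK /forall_inP indS.
rewrite -big_mkcondr sum1_card; apply/card_le1_eqP => v w.
rewrite ![_ \in _]unfold_in /= => /andP[vK vS] /andP[wK wS]; apply/eqP; apply: contraT => wv.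
have /forall_inP/(_ w wK) := clK v vK; rewrite eq_sym wv /= => vwadj.
by have /forall_inP/(_ w wS) := indS v vS; rewrite vwadj.
Qed.

Lemma clique_set1 (v : G) : clique (G := G) [set v].
Proof.
by apply/forall_inP => x /finset.set1P ->; apply/forall_inP => y /finset.set1P ->; rewrite eqxx.
Qed.

(** Perfection applied to the support of [w]: its cliques have at most [k] vertices, so [k] colours
    suffice, and the colour classes are the cover. *)
Lemma perfect_cover01 (w : G -> nat) k : perfect G -> (forall v, w v <= 1)%N ->
  (forall K, clique K -> \sum_(v in K) w v <= k)%N ->
  exists S : 'I_k -> {set G}, (forall i, independent (S i)) /\
    (forall v, w v <= \sum_i (v \in S i))%N.
Proof.
move=> Gperf w1 wK; pose U := [set v | (0 < w v)%N].
have chik : (chromatic_number (induced_subgraph U) <= k)%N.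
  rewrite Gperf /clique_number; apply/bigmax_leqP => T /forall_inP clT.
  apply: leq_trans (wK (val @: T) _).
    rewrite -(card_imset _ val_inj) -sum1_card; apply: leq_sum => _ /imsetP[x _ ->].
    by have := valP x; rewrite inE.
  apply/forall_inP => _ /imsetP[x xT ->]; apply/forall_inP => _ /imsetP[y yT ->].
  by have /forall_inP/(_ y yT) := clT x xT; rewrite -val_eqE.
move: chik; rewrite /chromatic_number.
case: ex_minnP => n /existsP[c /forallP colc] _ nk.
(* Colours are compared as numbers, so indices beyond the chromatic number give empty sets. *)
exists (fun i => [set v | [exists x : induced_subgraph U,
  (val x == v) && (val (c x) == val i)]]); split.
  move=> i; apply/forall_inP => v; rewrite inE => /existsP[x /andP[/eqP <- /eqP cx]].
  apply/forall_inP => v'; rewrite inE => /existsP[y /andP[/eqP <- /eqP cy]].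
  have /forallP/(_ y) := colc x; apply: contraL => xy; rewrite negb_imply negbK.
  by apply/andP; split; [exact: xy|apply/eqP/val_inj; rewrite cx cy].
move=> v; have [vU|] := boolP (v \in U); last by rewrite inE -eqn0Ngt => /eqP ->.
apply: leq_trans (w1 v) _; pose x : induced_subgraph U := exist _ v vU.
rewrite (bigD1 (widen_ord nk (c x))) //=.
suff -> : v \in [set v' | [exists y : induced_subgraph U,
  (val y == v') && (val (c y) == val (widen_ord nk (c x)))]] by [].
by rewrite inE; apply/existsP; exists x; rewrite !eqxx.
Qed.

(* Lovasz's replication lemma, without replicating vertices: decrease the weight
   of some [x] with [w x >= 2] and cover the rest with [k] classes; a class
   through [x] meets every clique of weight [k], so removing it leaves clique
   weights at most [k - 1]. *)
Lemma perfect_weighted_cover (w : G -> nat) k : perfect G ->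
  (forall K, clique K -> \sum_(v in K) w v <= k)%N ->
  exists S : 'I_k -> {set G}, (forall i, independent (S i)) /\
    (forall v, w v <= \sum_i (v \in S i))%N.
Proof.
move=> Gperf; have [n] := ubnP (\sum_v w v)%N; elim: n w k => // n IHn w k.
rewrite ltnS => wn wK; case: (pickP (fun x => 1 < w x)%N) => [x wx|w1]; last first.
  by apply: perfect_cover01 => // v; rewrite leqNgt w1.
have sum_lt (B : {set G}) y : y \in B -> (0 < w y)%N ->
    (forall K, y \in K -> \sum_(v in K) (w v - (v \in B)) < \sum_(v in K) w v)%N.
  move=> yB wy K yK; rewrite (bigD1 y) //= [ltnRHS](bigD1 y) //= yB -addSn.
  apply: leq_add; first by rewrite subn1 prednK.
  by apply: leq_sum => v _; apply: leq_subr.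
have sum_lt_all (B : {set G}) y : y \in B -> (0 < w y)%N ->
    (\sum_v (w v - (v \in B)) < n)%N.
  move=> yB wy; apply: leq_trans wn; have := sum_lt B y yB wy [set: G] (finset.in_setT _).
  by rewrite !(eq_bigl _ _ (fun v => finset.in_setT v)).
have wx0 := ltnW wx; pose w' v := (w v - (v \in [set x]))%N.
have [||S [indS Sw]] := IHn w' k.
- by apply: sum_lt_all wx0; rewrite finset.set11.
- move=> K /wK; apply: leq_trans; apply: leq_sum => v _; exact: leq_subr.
have [i xi] : exists i, x \in S i.
  apply/existsP; apply: contraTT wx => /existsPn noS.
  rewrite -leqNgt; have := Sw x; rewrite big1 => [|i _]; last by rewrite (negPf (noS i)).
  by rewrite leqn0 subn_eq0 finset.set11.
case: k wK S indS Sw i xi => [|k] wK S indS Sw i xi; first by case: i xi.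
(* Vertices with [w' v = 0] are dropped so that a clique meeting [A] loses weight when [A] is
   removed; on a clique avoiding [A], the [k] other classes already cover [w']. *)
pose A := [set v in S i | (0 < w' v)%N].
have xA : x \in A by rewrite inE xi /w' finset.set11 subn_gt0.
have [||T [indT Tw]] := IHn (fun v => w v - (v \in A))%N k.
- exact: sum_lt_all xA wx0.
- move=> K clK; have [/finset.set0Pn[y /finset.setIP[yK yA]]|KA] := boolP (K :&: A != finset.set0).
    rewrite -ltnS; apply: leq_trans (wK K clK); apply: (sum_lt A y) => //.
    by move: yA; rewrite inE => /andP[_]; rewrite /w' subn_gt0; apply: leq_ltn_trans.
  have xK : x \notin K.
    by apply: contra KA => xK; apply/finset.set0Pn; exists x; rewrite inE xK.
  have KA0 v : v \in K -> v \notin A.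
    by move=> vK; apply: contra KA => vA; apply/finset.set0Pn; exists v; rewrite inE vK.
  apply: (@leq_trans (\sum_(v in K) w' v)).
    apply: leq_sum => v vK; rewrite /w' finset.in_set1.
    by have [vx|_] := eqVneq v x; [rewrite -vx vK in xK|rewrite subn0 leq_subr].
  apply: (@leq_trans (\sum_(v in K) \sum_(j | j != i) (v \in S j))).
    apply: leq_sum => v vK; have [->//|w'v] := posnP (w' v).
    have := Sw v; rewrite (bigD1 i) //=.
    by have := KA0 v vK; rewrite inE w'v andbT => /negPf ->.
  rewrite exchange_big /=; apply: (@leq_trans (\sum_(j < k.+1 | j != i) 1)).
    by apply: leq_sum => j _; apply: clique_independent_le1 clK (indS j).
  by rewrite sum1_card cardC1 card_ord.
exists (fun j => oapp T A (unlift ord0 j)); split.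
  move=> j; case: unliftP => [j'|] _ /=; first exact: indT.
  apply/forall_inP => v; rewrite inE => /andP[vS _].
  apply/forall_inP => v'; rewrite inE => /andP[v'S _].
  by have /forall_inP/(_ v vS)/forall_inP := indS i; apply.
move=> v; rewrite big_ord_recl unlift_none /= -leq_subLR.
by apply: leq_trans (Tw v) _; apply: leq_sum => j _; rewrite liftK.
Qed.

Variable R : realType.

(** Round [N a] down and cover it by [N] independent sets; adding every singleton once makes up for
    the rounding and gives positivity. *)
Lemma perfect_fractional_cover (a : G -> R) (x : G) (N : nat) : perfect G ->
  (forall v, 0 <= a v) -> (forall K, clique K -> \sum_(v in K) a v <= 1) ->
  exists a' : G -> R, [/\ cover_weight a', forall v, 0 < a' v &
    forall v, N%:R / (N + #|G|)%:R * a v <= a' v].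
Proof.
move=> Gperf a0 aK.
pose w v := Num.truncn (N%:R * a v).
have Na0 v : 0 <= N%:R * a v by rewrite mulr_ge0.
have [K clK|S [indS Sw]] := @perfect_weighted_cover w N Gperf.
  rewrite -(ler_nat R) natr_sum; apply: (@le_trans _ _ (\sum_(v in K) N%:R * a v)).
    by apply: ler_sum => v _; rewrite truncn_le.
  by rewrite -mulr_sumr ler_piMr // aK.
pose T (k : 'I_N + G) := match k with inl i => S i | inr v => [set v] end.
pose M : R := (N + #|G|)%:R.
have M0 : 0 < M by rewrite ltr0n addn_gt0; apply/orP; right; apply/card_gt0P; exists x.
have cT : #|{: 'I_N + G}| = (N + #|G|)%N by rewrite card_sum card_ord.
exists (fun v => \sum_k unif_dist R (inr x : 'I_N + G) k * (v \in T k)%:R).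
have TE v : \sum_k unif_dist R (inr x : 'I_N + G) k * (v \in T k)%:R =
    M^-1 * ((\sum_i (v \in S i))%:R + 1).
  rewrite -mulr_sumr cT -/M; congr (_ * _); rewrite big_sumType natr_sum /=.
  congr (_ + _); rewrite (bigD1 v) //= finset.set11 big1 ?addr0 // => u uv.
  by rewrite finset.in_set1 eq_sym (negPf uv).
split.
- exists ('I_N + G)%type, (unif_dist R (inr x)), T; split=> // -[i|v]; first exact: indS.
  exact: independent_set1.
- by move=> v; rewrite TE mulr_gt0 ?invr_gt0 // ltr_wpDl.
move=> v; rewrite TE -/M [N%:R / M]mulrC -mulrA ler_pM2l ?invr_gt0 //.
apply: (@le_trans _ _ ((w v)%:R + 1)); last by rewrite lerD2r ler_nat.
by rewrite natr1 ltW // truncnS_gt.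
Qed.

End PerfectCover.

(** * Körner entropy between the two certificates *)

Section KornerEntropy.
Variables (R : realType) (G : pgraph R).
Local Notation P := (pgraph_dist G).

Section Channel.
Variable Q : G -> dist R (indep_set G).
Let joint v w := P v * Q v w.
Let r w := \sum_v joint v w.

Lemma joint_ge0 v w : 0 <= joint v w.
Proof. by rewrite mulr_ge0 ?dist_ge0. Qed.

Lemma joint_le_output v w : joint v w <= r w.
Proof.
by rewrite /r (bigD1 v) //= lerDl; apply: sumr_ge0 => u _; apply: joint_ge0.
Qed.

Lemma joint_sum v : \sum_w joint v w = P v.
Proof. by rewrite -mulr_sumr dist_sum1 mulr1. Qed.

Lemma output_ge0 w : 0 <= r w.
Proof. by apply: sumr_ge0 => v _; apply: joint_ge0. Qed.

Lemma output_sum1 : \sum_w r w = 1.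
Proof.
rewrite exchange_big -(dist_sum1 P); apply: eq_bigr => v _; exact: joint_sum.
Qed.

Lemma mutual_info_ln2 : mutual_info joint * ln 2 =
  \sum_v \sum_w joint v w * (ln (joint v w) - ln (P v) - ln (r w)).
Proof.
rewrite mulr_suml; apply: eq_bigr => v _; rewrite mulr_suml; apply: eq_bigr => w _.
rewrite /log2 mulrA divfK ?gt_eqF ?ln2_gt0 // joint_sum -/(r w).
have := joint_ge0 v w; rewrite le_eqVlt => /predU1P[<-|j0]; first by rewrite !mul0r.
have r0 : 0 < r w by apply: lt_le_trans (joint_le_output v w).
have [P0 _] := mulr_gt0_factors (dist_ge0 _ _) (dist_ge0 _ _) j0.
by rewrite ln_div ?posrE // ?(mulr_gt0 P0 r0) // lnM ?posrE // opprD addrA.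
Qed.

(** The argument for colourings, with the random independent set [W] as colour: [r w * t v] summed
    over [v \in w] has total at most 1. *)
Lemma mutual_info_ge L : theta_bound G L ->
  \sum_v \sum_(w : indep_set G | v \in val w) joint v w = 1 ->
  L <= mutual_info joint * ln 2.
Proof.
move=> [t [tt t0 tL]] supp1; apply: le_trans tL _; rewrite -subr_ge0.
(* The joint mass outside [V \in W] totals [1 - 1 = 0], so each of its nonnegative terms
   vanishes. *)
have supp v (w : indep_set G) : v \notin val w -> joint v w = 0.
  move=> vw; apply/eqP; rewrite eq_le joint_ge0 andbT.
  have : \sum_u \sum_(w : indep_set G | u \notin val w) joint u w = 0.
    apply: (addrI 1); rewrite addr0 -{1}supp1 -big_split /= -[RHS](dist_sum1 P).
    by apply: eq_bigr => u _; rewrite -joint_sum [RHS](bigID (fun w : indep_set G => u \in val w)).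
  rewrite (bigD1 v) //= (bigD1 w) //= => <-; rewrite -addrA lerDl addr_ge0 //.
    by apply: sumr_ge0 => *; apply: joint_ge0.
  by apply: sumr_ge0 => *; apply: sumr_ge0 => *; apply: joint_ge0.
rewrite mutual_info_ln2.
have -> : \sum_v \sum_w joint v w * (ln (joint v w) - ln (P v) - ln (r w)) -
    (weighted_cost t - weighted_cost P) =
    \sum_v \sum_w joint v w * (ln (joint v w) - ln (t v) - ln (r w)).
  rewrite /weighted_cost -!sumrB; apply: eq_bigr => v _.
  have -> x y : P v * x - P v * y = \sum_w joint v w * (x - y).
    by rewrite -mulr_suml joint_sum mulrBr.
  by rewrite -sumrB; apply: eq_bigr => w _; ring.
apply: (@le_trans _ _ (\sum_v \sum_w (joint v w - r w * (t v * (v \in val w)%:R)))).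
  under eq_bigr do rewrite sumrB joint_sum.
  rewrite sumrB dist_sum1 subr_ge0 exchange_big -[leRHS]output_sum1; apply: ler_sum => w _.
  rewrite -mulr_sumr ler_piMr ?output_ge0 //.
  apply: le_trans (theta_weight_independent tt (valP w)).
  rewrite [leRHS]big_mkcond; apply: ler_sum => v _.
  by case: (v \in val w); rewrite ?mulr1 ?mulr0.
apply: ler_sum => v _; apply: ler_sum => w _.
have [vw|/supp ->] := boolP (v \in val w); last by rewrite mulr0 mulr0 subrr mul0r.
rewrite mulr1; apply: gibbs_term.
- exact: joint_ge0.
- exact: theta_weight_ge0.
- exact: output_ge0.
- by move=> /(mulr_gt0_factors (dist_ge0 _ _) (dist_ge0 _ _))[P0 _]; apply: t0.
- by move=> j0; apply: lt_le_trans j0 (joint_le_output v w).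
Qed.

End Channel.

Lemma cover_weight_indep_set (a : G -> R) : cover_weight a ->
  exists q : dist R (indep_set G), forall v, \sum_w q w * (v \in val w)%:R = a v.
Proof.
case=> I [d [S [indS Sa]]]; pose T i : indep_set G := exist _ (S i) (indS i).
exists (Dist (image_law_ge0 T d) (image_law_sum1 T d)) => v /=.
rewrite -Sa [RHS](partition_big T xpredT) //=; apply: eq_bigr => w _.
by rewrite mulr_suml; apply: eq_bigr => i /eqP <-.
Qed.

(** Given [v], draw [W] from the law [q] of the cover conditioned on containing [v]; then [I(W; V)]
    is [- weighted_cost a] minus the relative entropy of the output law from [q]. *)
Lemma cover_bound_channel k m : cover_bound G k m ->
  exists Q : G -> dist R (indep_set G),
    let joint v w := P v * Q v w in
    \sum_v \sum_(w : indep_set G | v \in val w) joint v w = 1 /\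
    mutual_info joint * ln 2 <= k.
Proof.
move=> [a [/cover_weight_indep_set [q qa] a0 ak _]].
have Q_ge0 v w : 0 <= q w * (v \in val w)%:R / a v.
  by rewrite divr_ge0 ?mulr_ge0 ?dist_ge0 ?(ltW (a0 v)).
have Q_sum1 v : \sum_w q w * (v \in val w)%:R / a v = 1.
  by rewrite -mulr_suml qa divff // gt_eqF.
pose Q v := Dist (Q_ge0 v) (Q_sum1 v).
exists Q => joint; split.
  rewrite -[RHS](dist_sum1 P); apply: eq_bigr => v _.
  rewrite -mulr_sumr big_mkcond /=.
  rewrite (eq_bigr (fun w => q w * (v \in val w)%:R / a v)) ?Q_sum1 ?mulr1 // => w _.
  by case: (v \in val w); rewrite // mulr0 mul0r.
rewrite (mutual_info_ln2 Q); set r := fun w => \sum_v P v * Q v w.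
apply: le_trans ak.
have -> : \sum_v \sum_w P v * Q v w *
    (ln (P v * Q v w) - ln (P v) - ln (\sum_u P u * Q u w)) =
    \sum_v \sum_w P v * Q v w * (- ln (a v)) +
    \sum_v \sum_w P v * Q v w * (ln (q w) - ln (r w)).
  rewrite -big_split; apply: eq_bigr => v _ /=; rewrite -big_split.
  apply: eq_bigr => w _; rewrite /= -/(r w) -mulrDr.
  have := dist_ge0 P v; rewrite le_eqVlt => /predU1P[<-|P0]; first by rewrite !mul0r.
  have [vw|vw] := boolP (v \in val w); last by rewrite !(mulr0, mul0r).
  have := dist_ge0 q w; rewrite le_eqVlt => /predU1P[<-|q0]; first by rewrite !(mulr0, mul0r).
  rewrite mulr1 lnM ?posrE ?divr_gt0 // ln_div ?posrE //; congr (_ * _); ring.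
have -> : \sum_v \sum_w P v * Q v w * (- ln (a v)) = - weighted_cost a.
  rewrite /weighted_cost -sumrN; apply: eq_bigr => v _.
  by rewrite -mulr_suml joint_sum mulrN.
(* Gibbs' inequality with [t = 1] shows that the relative entropy of [r] from [q] is nonnegative. *)
rewrite gerDl exchange_big /=.
under eq_bigr => w _ do rewrite -mulr_suml -/(r w).
rewrite -oppr_ge0 -sumrN.
have : 0 <= \sum_w (r w - q w * 1).
  by rewrite sumrB (output_sum1 Q) -mulr_suml dist_sum1 mulr1 subrr.
move/le_trans; apply; apply: ler_sum => w _.
apply: le_trans (gibbs_term _ _ _ _ _) _; rewrite ?ler01 ?dist_ge0 ?(output_ge0 Q) //.
  move=> r0; rewrite lt_neqAle dist_ge0 andbT eq_sym; apply: contraTneq r0 => q0.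
  by rewrite /r big1 ?ltxx // => v _; rewrite /= q0 !mul0r mulr0.
by rewrite ln1 subr0 -mulrN opprB.
Qed.

Lemma korner_entropy_bounds L k m : theta_bound G L -> cover_bound G k m ->
  L <= korner_entropy G * ln 2 <= k.
Proof.
move=> GL /cover_bound_channel [Q [Q1 Qk]]; rewrite -ler_pdivrMr ?ln2_gt0 //.
have lb : lbound [set h | exists Q : G -> dist R (indep_set G),
    let joint v w := P v * Q v w in
    \sum_v \sum_(w : indep_set G | v \in val w) joint v w = 1 /\
    h = mutual_info joint]%classic (L / ln 2).
  move=> _ [Q' [Q'1 ->]]; rewrite ler_pdivrMr ?ln2_gt0 //.
  exact: mutual_info_ge.
apply/andP; split; first by apply: lb_le_inf lb; eexists; exists Q.
apply: le_trans Qk; rewrite ler_pM2r ?ln2_gt0 //; apply: ge_inf; last by exists Q.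
by exists (L / ln 2).
Qed.

End KornerEntropy.

(** * Nearly matching certificates for a perfect graph *)

Section PerfectBounds.
Variables (R : realType) (G : pgraph R).
Local Notation P := (pgraph_dist G).
Local Notation cliques := {K : {set G} | clique K}.

Let b_of (d : dist R cliques) v : R := \sum_K d K * (v \in val K)%:R.

(** Indicators equal their squares, and no clique contains two distinct non-adjacent vertices. *)
Lemma clique_theta_weight d : theta_weight (b_of d).
Proof.
exists cliques, d, (fun v (K : cliques) => (v \in val K)%:R); split=> // [v|v w vw nadj].
  by apply: eq_bigr => K _; case: (v \in val K); rewrite ?expr1n ?expr0n.
apply: big1 => K _; rewrite -natrM mulnb.
case: andP => [[vK wK]|]; last by rewrite mulr0.
have /forall_inP/(_ v vK)/forall_inP/(_ w wK) := valP K.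
by rewrite vw (negPf nadj).
Qed.

Lemma b_of_le1 d v : b_of d v <= 1.
Proof.
rewrite -[leRHS](dist_sum1 d); apply: ler_sum => K _.
by rewrite ler_piMr ?dist_ge0 ?lern1 ?leq_b1.
Qed.

Lemma b_of_mix (e : R) (e0 : 0 <= e) p q v :
  b_of (mix_dist e0 p q) v = (b_of p v + e * b_of q v) / (1 + e).
Proof.
rewrite /b_of mulr_sumr -big_split mulr_suml; apply: eq_bigr => K _ /=; ring.
Qed.

Lemma b_of_point K v : b_of (point_dist R K) v = (v \in val K)%:R.
Proof.
rewrite /b_of (bigD1 K) //= eqxx mul1r big1 ?addr0 // => K' /negPf K'K.
by rewrite K'K mul0r.
Qed.

(** Positivity is imposed because [ln 0 = 0] would otherwise reward vanishing coordinates. *)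
Let values := [set h | exists d, (forall v, 0 < b_of d v) /\
  h = weighted_cost (b_of d)]%classic.

Let K0 : cliques.
Proof.
exists finset.set0; apply/forall_inP => x; by rewrite finset.in_set0.
Defined.

Let b_unif v : #|{: cliques}|%:R^-1 <= b_of (unif_dist R K0) v.
Proof.
rewrite /b_of (bigD1 (exist _ [set v] (clique_set1 v))) //= finset.set11 mulr1 lerDl.
by apply: sumr_ge0 => K _; rewrite mulr_ge0 ?invr_ge0.
Qed.

Let M : R := #|{: cliques}|%:R.
Let M0 : 0 < M. Proof. by rewrite ltr0n; apply/card_gt0P; exists K0. Qed.

Let values_sup : has_sup values.
Proof.
split.
  exists (weighted_cost (b_of (unif_dist R K0))), (unif_dist R K0); split=> // v.
  by apply: lt_le_trans (b_unif v); rewrite invr_gt0.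
exists 0 => _ [d [d0 ->]]; apply: sumr_le0 => v _.
by rewrite mulr_ge0_le0 ?dist_ge0 ?ln_le0 ?b_of_le1.
Qed.

(* Approximate Kuhn-Tucker conditions at a near-maximizer [b] of
   [sum P ln b] over convex combinations of cliques. *)
Lemma near_optimal_weights (h : R) : 0 < h -> exists b a : G -> R,
  [/\ theta_weight b /\ forall v, 0 < b v,
      forall v, 0 <= a v /\ (0 < P v -> 0 < a v),
      forall K : {set G}, clique K -> \sum_(v in K) a v <= 1 &
      - weighted_cost a <=
        weighted_cost b - weighted_cost P + (h ^+ 2 + h * M + h)].
Proof.
move=> h0; have h1 : 0 < 1 + h by rewrite ltr_wpDr // ltW.
(* The clique test below moves by a step [h]: dividing by [h] turns the slack [h ^+ 2] into [h]. *)
have [_ [d [b0 ->]] near_sup] := sup_adherent (exprn_gt0 2 h0) values_sup.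
set b := b_of d in b0 near_sup *.
have better (e : R) (e0 : 0 <= e) q : \sum_v P v * ln (b v + e * b_of q v) <=
    weighted_cost b + h ^+ 2 + ln (1 + e).
  have e1 : 0 < 1 + e by rewrite ltr_wpDr.
  have q0 v : 0 < b v + e * b_of q v.
    by rewrite ltr_wpDr // mulr_ge0 // (theta_weight_ge0 v (clique_theta_weight q)).
  have : weighted_cost (b_of (mix_dist e0 d q)) <= sup values.
    apply: ub_le_sup; first by case: values_sup.
    by exists (mix_dist e0 d q); split=> // v; rewrite b_of_mix divr_gt0.
  have -> : weighted_cost (b_of (mix_dist e0 d q)) =
      \sum_v P v * ln (b v + e * b_of q v) - ln (1 + e).
    rewrite /weighted_cost -[X in _ - X]mul1r -[X in _ - X * _](dist_sum1 P) mulr_suml -sumrB.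
    by apply: eq_bigr => v _; rewrite b_of_mix ln_div ?posrE // mulrBr.
  lra.
have ln1D (e : R) : 0 <= e -> ln (1 + e) <= e.
  by move=> e0; apply: le_ln1Dx; apply: lt_le_trans e0; rewrite ltrN10.
(* A move by [h] towards a clique raises each of its logarithms by at least [h / (b v + h)], so
   near-optimality bounds the clique sums of [P / (b + h)] by [1 + h]. *)
pose a v := P v / ((b v + h) * (1 + h)).
have bh v : 0 < b v + h by rewrite addr_gt0.
exists b, a; split.
- by split=> //; apply: clique_theta_weight.
- move=> v; split; first by rewrite divr_ge0 ?dist_ge0 // ltW // mulr_gt0.
  by move=> Pv; rewrite divr_gt0 ?mulr_gt0.
- move=> K clK; rewrite /a.
  have -> : \sum_(v in K) P v / ((b v + h) * (1 + h)) =
      (\sum_(v in K) P v / (b v + h)) / (1 + h).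
    by rewrite mulr_suml; apply: eq_bigr => v _; rewrite invfM mulrA.
  rewrite ler_pdivrMr // mul1r -(ler_pM2l h0).
  have := better h (ltW h0) (point_dist R (exist _ K clK)).
  have := ln1D h (ltW h0).
  have : h * \sum_(v in K) P v / (b v + h) <=
      \sum_v P v * ln (b v + h * b_of (point_dist R (exist _ K clK)) v) - weighted_cost b.
    rewrite /weighted_cost -sumrB mulr_sumr big_mkcond; apply: ler_sum => v _.
    rewrite b_of_point /=; case: (v \in K); last by rewrite mulr0 addr0 subrr.
    rewrite mulr1 -mulrBr mulrCA ler_wpM2l ?dist_ge0 //.
    have : ln (b v / (b v + h)) <= b v / (b v + h) - 1 by rewrite ln_le_sub1 ?divr_gt0.
    rewrite ln_div ?posrE //.
    have -> : b v / (b v + h) - 1 = - (h / (b v + h)) by field; rewrite gt_eqF.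
    lra.
  by rewrite -/b; nra.
have -> : weighted_cost a = weighted_cost P - \sum_v P v * ln (b v + h) - ln (1 + h).
  rewrite /weighted_cost -[X in _ - X]mul1r -[X in _ - X * _](dist_sum1 P) mulr_suml -!sumrB.
  apply: eq_bigr => v _; have := dist_ge0 P v.
  rewrite le_eqVlt => /predU1P[<-|Pv]; first by rewrite !mul0r !subr0.
  by rewrite /a ln_div ?posrE ?mulr_gt0 // lnM ?posrE //; ring.
have hM : 0 <= h * M by rewrite mulr_ge0 // ltW.
(* Since the uniform law on cliques gives each vertex at least [1 / M], adding [h] is dominated by a
   move of size [h * M] towards it. *)
have : \sum_v P v * ln (b v + h) <= \sum_v P v * ln (b v + h * M * b_of (unif_dist R K0) v).
  apply: ler_sum => v _; rewrite ler_wpM2l ?dist_ge0 //.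
  have : b v + h <= b v + h * M * b_of (unif_dist R K0) v.
    rewrite lerD2l -mulrA ler_peMr ?(ltW h0) // -ler_pdivrMl // mulr1.
    exact: b_unif.
  by move=> le; rewrite ler_ln ?posrE // (lt_le_trans (bh v) le).
have := better _ hM (unif_dist R K0); have := ln1D _ hM; have := ln1D _ (ltW h0).
lra.
Qed.

Lemma perfect_bounds (e : R) : perfect G -> 0 < e ->
  exists L m, theta_bound G L /\ cover_bound G (L + e) m.
Proof.
(* Half of [e] pays for the Kuhn-Tucker error through [h], the other half for the rounding through
   [N]. *)
move=> G_perfect e0; pose h := e / (2 * (M + 2 + e)).
have D0 : 0 < M + 2 + e by rewrite !addr_gt0.
have h0 : 0 < h by rewrite divr_gt0 ?mulr_gt0.
have hE : h * (2 * (M + 2 + e)) = e by rewrite divfK // gt_eqF // mulr_gt0.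
have [b [a [[tb b0] a0 aK ca]]] := near_optimal_weights h0.
have hle : h ^+ 2 + h * M + h <= e / 2 by have := M0; nra.
have [x _] := dist_inhabited P.
have V0 : 0 < #|G|%:R :> R by rewrite ltr0n; apply/card_gt0P; exists x.
pose N := (Num.truncn (2 * #|G|%:R / e)).+1.
have Nlt : 2 * #|G|%:R / e < N%:R by rewrite truncnS_gt.
have N0 : 0 < N%:R :> R by rewrite ltr0n.
have [a' [ca' a'0 aa']] := perfect_fractional_cover x N G_perfect (fun v => (a0 v).1) aK.
exists (weighted_cost b - weighted_cost P).
suff : - weighted_cost a' <= weighted_cost b - weighted_cost P + e.
  move/(cover_weight_bound ca' a'0) => [m Gm]; exists m; split=> //.
  by exists b; split=> // v _.
have ratio0 : 0 < N%:R / (N + #|G|)%:R :> R by rewrite divr_gt0 // ltr0n addSn.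
have : weighted_cost a + ln (N%:R / (N + #|G|)%:R) <= weighted_cost a'.
  rewrite /weighted_cost -[X in _ + X]mul1r -[X in _ + X * _](dist_sum1 P) mulr_suml -big_split.
  apply: ler_sum => v _ /=; have := dist_ge0 P v.
  rewrite le_eqVlt => /predU1P[<-|Pv]; first by rewrite !mul0r addr0.
  have av := (a0 v).2 Pv; rewrite -mulrDr ler_pM2l // addrC -lnM ?posrE //.
  by rewrite ler_ln ?posrE // (mulr_gt0 ratio0 av).
have : - ln (N%:R / (N + #|G|)%:R) <= e / 2.
  rewrite -lnV ?posrE // invf_div natrD mulrDl divff ?gt_eqF //.
  apply: le_trans (le_ln1Dx _) _.
    by apply: lt_le_trans (_ : 0 <= _); rewrite ?ltrN10 // divr_ge0 // ltW.
  by move: Nlt; rewrite ltr_pdivrMr // ler_pdivrMr // => h2; lra.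
lra.
Qed.

End PerfectBounds.

Theorem mainTheorem6 (R : realType) (G : pgraph R) (G_perfect : perfect G) :
  complementary_entropy (and_prod G (pentagon R))
    = complementary_entropy G + complementary_entropy (pentagon R)
  /\ complementary_entropy G + complementary_entropy (pentagon R)
    = korner_entropy G + 2^-1 * log2 (5 : R).
Proof.
set kappa := korner_entropy G * ln 2.
(* The sandwich puts [kappa] between [L] and [L + e], so both certificates can be recentred at
   [kappa]. *)
have thG e : 0 < e -> theta_bound G (kappa - e).
  move=> e0; have [L [m [[t [tt t0 tL]] cov]]] := perfect_bounds G_perfect e0.
  have /andP[_ kL] := korner_entropy_bounds (ex_intro _ t (And3 tt t0 tL)) cov.
  by exists t; split=> //; apply: le_trans tL; rewrite lerBlDr.
have cvG e : 0 < e -> exists m, cover_bound G (kappa + e) m.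
  move=> e0; have [L [m [th cov]]] := perfect_bounds G_perfect e0.
  have /andP[Lk _] := korner_entropy_bounds th cov.
  by exists m; apply: cover_bound_le cov; rewrite ?lerD2r.
have cvGG e : 0 < e -> exists m, cover_bound (and_prod G G) (2 * (kappa + e)) m.
  move=> /cvG [m cov]; exists (m + m); rewrite mulr_natl mulr2n.
  exact: cover_bound_prod.
have [m5 cv5] := pentagon_cover_bound R.
have th5 e : 0 < e -> theta_bound (pentagon R) (ln 5 / 2 - e).
  move=> e0; have [t [tt t0 tL]] := pentagon_theta_bound R.
  by exists t; split=> //; apply: le_trans tL; rewrite gerBl ltW.
have -> : complementary_entropy G = korner_entropy G.
  by rewrite (complementary_entropy_eq thG cvGG) mulfK // gt_eqF // ln2_gt0.
have -> : complementary_entropy (pentagon R) = 2^-1 * log2 5.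
  rewrite (@complementary_entropy_eq _ _ (ln 5 / 2) th5) => [|e e0].
    by rewrite /log2 mulrAC mulrC.
  exists m5; apply: cover_bound_le cv5 => //.
  by rewrite mulrDr mulrC divfK // lerDl mulr_ge0 // ltW.
split=> //; rewrite (@complementary_entropy_eq _ _ (kappa + ln 5 / 2)).
- by rewrite mulrDl mulfK ?gt_eqF ?ln2_gt0 // /log2 mulrA [2^-1 * _]mulrC.
- move=> e e0; rewrite addrAC.
  apply: theta_bound_prod; last exact: pentagon_theta_bound.
  exact: thG.
move=> e e0; have [m cov] := cvGG e e0; exists (m + m5).
(* Regrouping the square of the product allows Shannon's cover of the square of the pentagon to be
   used. *)
apply: cover_bound_swap; have -> : 2 * (kappa + ln 5 / 2 + e) = 2 * (kappa + e) + ln 5.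
  by field.
exact: cover_bound_prod.
Qed.
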